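(* With $u_2=-4K^2$, $$\alpha'_3=16\,\mathrm{discr}_z\bigl(z^3+\sigma_1z^2+(\sigma_2+u_2)z+\sigma_3\bigr),$$ as polynomials in $u_2$ (with $16K^2=-4u_2$) and $\sigma_1,\sigma_2,\sigma_3$.
   Context: An $(n+1)$-gon is semicyclic if it is inscribed in a circle and one of its sides is a diameter of that circle (polygons are oriented and may be non-convex and self-intersecting; the area $K$ is the signed area $\oint x\,dy$). For $n\ge2$, $\alpha'_n$ is the unique irreducible polynomial with integer coefficients in $n+1$ variables, monic in the first variable, homogeneous when the first variable has degree $2$ and the others degree $1$, such that $\alpha'_n(16K^2,a_1^2,\dots,a_n^2)=0$ whenever $a_1,\dots,a_n$ are the lengths of the sides, excluding a diameter, of a semicyclic $(n+1)$-gon of area $K$. It is symmetric in the last $n$ variables, hence a polynomial in $16K^2$ and the elementary symmetric functions $\sigma_1,\dots,\sigma_n$ of $a_1^2,\dots,a_n^2$. $\mathrm{discr}_z$ is the discriminant of a polynomial in $z$. *)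

(* Defs.v *)
From HB Require Import structures.
From mathcomp Require Import all_boot all_order all_algebra.
From mathcomp Require Import reals.
From mathcomp Require Import mpoly.

Set Implicit Arguments.
Unset Strict Implicit.
Unset Printing Implicit Defensive.

Import Order.TTheory GRing.Theory Num.Theory.
Local Open Scope ring_scope.

Section Polygons.
Context {R : realType}.

Definition dist (p q : R * R) : R :=
  Num.sqrt ((p.1 - q.1) ^+ 2 + (p.2 - q.2) ^+ 2).

(* An oriented m-gon is the cyclic sequence v 0, ..., v (m-1) of its vertices,
   without further restriction; side i joins v i to v (i+1 mod m). *)
Definition side_length {m : nat} (v : 'I_m -> R * R) (i : 'I_m) : R :=
  dist (v i) (v (ordS i)).

(* The integral of x dy along the closed polygonal line: on the segment from p
   to q it equals (p.1 + q.1) / 2 * (q.2 - p.2). *)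
Definition signed_area {m : nat} (v : 'I_m -> R * R) : R :=
  \sum_(i < m) ((v i).1 + (v (ordS i)).1) / 2 * ((v (ordS i)).2 - (v i).2).

Definition inscribed {m : nat} (v : 'I_m -> R * R) (c : R * R) (r : R) : Prop :=
  0 < r /\ forall i, dist c (v i) = r.

(* Side i of v is a diameter of the circumcircle: the centre c is its midpoint. *)
Definition semicyclic_at {m : nat} (v : 'I_m -> R * R) (i : 'I_m) : Prop :=
  exists (c : R * R) (r : R), inscribed v c r /\ v i + v (ordS i) = c *+ 2.

End Polygons.

Definition irreducible_elt {A : idomainType} (p : A) : Prop :=
  [/\ p != 0, p \isn't a GRing.unit &
      forall a b : A, p = a * b -> a \is a GRing.unit \/ b \is a GRing.unit].

(* The unique term of maximal degree d in the first variable is 'X_0 ^+ d. *)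
Definition monic_in_first {A : nzRingType} {n : nat} (P : {mpoly A[n.+1]}) : Prop :=
  exists d : nat, P@_(U_(ord0) *+ d)%MM = 1 /\
    forall m, m \in msupp P -> m != (U_(ord0) *+ d)%MM -> (m ord0 < d)%N.

Definition area_weight {n : nat} (m : 'X_{1..n.+1}) : nat :=
  (2 * m ord0 + \sum_(j < n) m (lift ord0 j))%N.

Fact area_weight0 n : area_weight (0%MM : 'X_{1..n.+1}) = 0%N.
Proof.
by rewrite /area_weight mnm0E muln0 add0n big1 // => j _; rewrite mnm0E.
Qed.

Fact area_weightD n :
  {morph @area_weight n : m1 m2 / (m1 + m2)%MM >-> (m1 + m2)%N}.
Proof.
move=> m1 m2; rewrite /area_weight mnmDE mulnDr addnACA -big_split /=.
by congr (_ + _)%N; apply: eq_bigr => j _; rewrite mnmDE.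
Qed.

HB.instance Definition _ n :=
  isMeasure.Build n.+1 area_weight (@area_weight0 n) (@area_weightD n).

(* The point (16 K^2, a_1^2, ..., a_n^2), where a_1, ..., a_n are the lengths of
   the sides of v other than side i. *)
Definition area_point {R : realType} {n : nat} (v : 'I_n.+1 -> R * R)
    (i : 'I_n.+1) (k : 'I_n.+1) : R :=
  if unlift ord0 k is Some j then side_length v (lift i j) ^+ 2
  else 16 * signed_area v ^+ 2.

Definition vanishes_on_semicyclic (R : realType) {n : nat}
    (P : {mpoly int[n.+1]}) : Prop :=
  forall (v : 'I_n.+1 -> R * R) (i : 'I_n.+1),
    semicyclic_at v i -> mmap intr (area_point v i) P = 0.

(* P is the generalized Heron polynomial alpha'_n. *)
Definition is_alpha' (R : realType) (n : nat) (P : {mpoly int[n.+1]}) : Prop :=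
  [/\ irreducible_elt P, monic_in_first P,
      P \is ishomog (@area_weight n) & vanishes_on_semicyclic R P].
Arguments is_alpha' : clear implicits.

(* The division is meaningful when the leading coefficient is a unit, in
   particular for monic p.  The argument order in [resultant] is immaterial
   here, since deg p * deg p' is even. *)
Definition discr {A : idomainType} (p : {poly A}) : A :=
  (-1) ^+ 'C((size p).-1, 2) * resultant p p^`() / lead_coef p.

(* In n+1 variables, the k-th elementary symmetric polynomial of the last n. *)
Definition sigma {n : nat} (k : nat) : {mpoly int[n.+1]} :=
  mesym n int k \mPo [tuple 'X_(lift ord0 j) | j < n].

(* Rewrites a polynomial in 16 K^2, a_1^2, ..., a_n^2 as a polynomial in
   u2, a_1^2, ..., a_n^2, where 16 K^2 = - 4 u2. *)
Definition in_u2 {n : nat} (P : {mpoly int[n.+1]}) : {mpoly int[n.+1]} :=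
  P \mPo [tuple (if k == ord0 then - 4 * 'X_ord0 else 'X_k) | k < n.+1].

(* Main.v *)
(* Write K for the area and h for 16 times the discriminant, which is a monic
cubic in x = 16 K^2 with integer coefficients. Put the centre of the circle at
the origin, so that the vertices are p, -p, q, s; the Gram determinant of
these plane vectors vanishes, and it divides the value of h, so h vanishes on
semicyclic quadrilaterals. Modulo 5, at the side squares (1, 2, 3), for which
the elementary symmetric functions are all 1, the cubic h has no root; hence h
has no factor of degree 1 in x, and it is irreducible. Conversely, let P
vanish on semicyclic quadrilaterals and let T be its remainder modulo h. Any
positive side squares are realized by a semicyclic quadrilateral, so at all
positive integers congruent to (1, 2, 3) modulo 5 the polynomial T, of degree
at most 2 in x, shares a real root with an irreducible rational cubic. Thus T
= 0 and h divides P. *)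
Require Import Defs.
From HB Require Import structures.
From mathcomp Require Import all_boot all_order all_algebra.
From mathcomp Require Import reals.
From mathcomp Require Import mpoly ring.

Import Order.TTheory GRing.Theory Num.Theory.
Local Open Scope ring_scope.

(** * Splitting off the first variable *)

Definition mcons {n : nat} (k : nat) (m : 'X_{1..n}) : 'X_{1..n.+1} :=
  [multinom if unlift ord0 i is Some j then m j else k | i < n.+1].

Lemma mcons0 n k (m : 'X_{1..n}) : mcons k m ord0 = k.
Proof. by rewrite mnmE unlift_none. Qed.

Lemma mconsS n k (m : 'X_{1..n}) j : mcons k m (lift ord0 j) = m j.
Proof. by rewrite mnmE liftK. Qed.

Lemma mcons_tail n (m : 'X_{1..n.+1}) :
  m = mcons (m ord0) [multinom m (lift ord0 j) | j < n].
Proof. by apply/mnmP=> i; rewrite mnmE; case: unliftP => [j|] -> //; rewrite mnmE. Qed.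

Lemma mcons_eq n k (m : 'X_{1..n}) (m' : 'X_{1..n.+1}) :
  (m' == mcons k m) = (m' ord0 == k) && ([multinom m' (lift ord0 j) | j < n] == m).
Proof.
apply/eqP/andP=> [-> | [/eqP <- /eqP <-]]; last exact: mcons_tail.
by rewrite mcons0; split=> //; apply/eqP/mnmP=> j; rewrite mnmE mconsS.
Qed.

Lemma mmap1_recl n (S : comNzRingType) (h : 'I_n.+1 -> S) m :
  mmap1 h m = h ord0 ^+ m ord0 *
    mmap1 (h \o lift ord0) [multinom m (lift ord0 j) | j < n].
Proof.
by rewrite /mmap1 big_ord_recl; congr (_ * _); apply: eq_bigr=> j _; rewrite mnmE.
Qed.

Section SplitFirstVariable.
Context {R : comNzRingType} {n : nat}.

Definition msplit_var (i : 'I_n.+1) : {poly {mpoly R[n]}} :=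
  if unlift ord0 i is Some j then ('X_j)%:P else 'X.

(** Makes degree, division and roots with respect to the first variable, here [16 K^2], available
    from the univariate theory. *)
Definition msplit (p : {mpoly R[n.+1]}) : {poly {mpoly R[n]}} :=
  mmap (polyC \o @mpolyC n R) msplit_var p.

HB.instance Definition _ := GRing.RMorphism.copy msplit
  (mmap (polyC \o @mpolyC n R) msplit_var).

Definition mlift (p : {mpoly R[n]}) : {mpoly R[n.+1]} :=
  p \mPo [tuple 'X_(lift ord0 j) | j < n].

HB.instance Definition _ := GRing.RMorphism.copy mlift
  (comp_mpoly [tuple 'X_(lift ord0 j) | j < n]).

Definition munsplit (p : {poly {mpoly R[n]}}) : {mpoly R[n.+1]} :=
  (map_poly mlift p).['X_ord0].

Lemma msplitXm (m : 'X_{1..n.+1}) :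
  msplit 'X_[m] = ('X_[[multinom m (lift ord0 j) | j < n]])%:P * 'X^(m ord0).
Proof.
rewrite /msplit mmapX mmap1_recl /msplit_var unlift_none mulrC; congr (_ * _).
rewrite -mmap1_id /mmap1 rmorph_prod /=; apply: eq_bigr=> j _.
by rewrite liftK rmorphXn.
Qed.

Lemma msplitE (p : {mpoly R[n.+1]}) k m : (msplit p)`_k@_m = p@_(mcons k m).
Proof.
rewrite /msplit /mmap coef_sum !raddf_sum /= {3}(mpolyE p) raddf_sum /=.
apply: eq_bigr=> m' _; rewrite mcoeffZ mcoeffX mcons_eq.
rewrite -[mmap1 _ _](mmapX _ (polyC \o @mpolyC n R)) -/(msplit _) msplitXm /=.
rewrite coefCM mcoeffCM coefCM coefXn [k == _]eq_sym; case: eqP => _ /=.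
  by rewrite mulr1 mcoeffX.
by rewrite mulr0 mcoeff0 mulr0.
Qed.

Lemma msplit_inj : injective msplit.
Proof.
move=> p q e; apply/mpolyP=> m.
by rewrite (mcons_tail _ m) -!msplitE e.
Qed.

Lemma mliftX j : mlift 'X_j = 'X_(lift ord0 j).
Proof. by rewrite /mlift comp_mpolyXU (nth_map j) ?size_enum_ord // nth_ord_enum. Qed.

Lemma msplit_lift p : msplit (mlift p) = p%:P.
Proof.
elim/mpolyind: p => [|c m p _ _ IH]; first by rewrite !rmorph0.
rewrite !rmorphD /= IH -mul_mpolyC !rmorphM /=; congr (_ * _ + _).
  by rewrite /mlift comp_mpolyC /msplit mmapC.
rewrite -mmap1_id /mmap1 !rmorph_prod /=; apply: eq_bigr=> j _.
rewrite !rmorphXn /= mliftX /msplit mmapX mmap1U /msplit_var liftK //.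
Qed.

Lemma msplit_X0 : msplit 'X_ord0 = 'X.
Proof. by rewrite /msplit mmapX mmap1U /msplit_var unlift_none. Qed.

Lemma munsplitK : cancel munsplit msplit.
Proof.
move=> p; rewrite /munsplit -horner_map /= msplit_X0 -map_poly_comp.
rewrite (eq_map_poly (g := polyC)); first exact: comp_polyXr.
exact: msplit_lift.
Qed.

Lemma msplitK : cancel msplit munsplit.
Proof. by move=> p; apply: msplit_inj; rewrite munsplitK. Qed.

Lemma munsplitM : {morph munsplit : p q / p * q}.
Proof. by move=> p q; apply: msplit_inj; rewrite rmorphM /= !munsplitK. Qed.

(** Turns vanishing at a point into a root, at the first coordinate, of a univariate polynomial over
    the target ring. *)
Lemma mmap_msplit (S : comNzRingType) (f : {rmorphism R -> S}) (h : 'I_n.+1 -> S) p :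
  mmap f h p = (map_poly (mmap f (h \o lift ord0)) (msplit p)).[h ord0].
Proof.
have mapM : {morph map_poly (mmap f (h \o lift ord0)) : u v / u * v}.
  exact: rmorphM.
have sumE : {morph map_poly (mmap f (h \o lift ord0)) : u v / u + v}.
  exact: rmorphD.
have splitM : {morph msplit : u v / u * v} by exact: rmorphM.
have splitD : {morph msplit : u v / u + v} by exact: rmorphD.
have split0 : msplit 0 = 0 by exact: rmorph0.
rewrite {2}(mpolyE p) (big_morph _ splitD split0) (big_morph _ sumE (rmorph0 _)).
rewrite horner_sum.
rewrite /mmap; apply: eq_bigr => m _.
rewrite -mul_mpolyC splitM mapM hornerM; congr (_ * _).
  by rewrite /msplit mmapC /= map_polyC hornerC /= mmapC.
rewrite mmap1_recl msplitXm mapM map_polyC map_polyXn.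
by rewrite hornerM hornerC hornerXn mulrC /= mmapX.
Qed.

End SplitFirstVariable.

(** * The discriminant of a cubic *)

Lemma resultant_mxE (R : nzRingType) (p q : {poly R}) m n :
  size p = m.+1 -> size q = n.+1 ->
  resultant p q = \det (\matrix_(i < n + m, j < n + m)
    if (i < n)%N then p`_(j - i) *+ (i <= j)
    else q`_(j - (i - n)) *+ (i - n <= j)).
Proof.
move=> sp sq; rewrite /resultant; have := @Sylvester_mxE _ p q.
move: (Sylvester_mx p q); rewrite sp sq /= => S SE; congr (\det _).
apply/matrixP => i j; rewrite SE mxE.
by case: splitP => k -> //; rewrite addKn.
Qed.

Lemma det_mx_nat_recl (R : comNzRingType) n (F : nat -> nat -> R) :
  \det (\matrix_(i < n.+1, j < n.+1) F i j) =
  \sum_(j < n.+1)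
    F 0 j * ((-1) ^+ j * \det (\matrix_(i < n, k < n) F i.+1 (bump j k))).
Proof.
rewrite (expand_det_row _ ord0); apply: eq_bigr => j _.
rewrite mxE /cofactor; congr (_ * (_ * \det _)).
by apply/matrixP => i k; rewrite !mxE.
Qed.

(** Cofactor expansion on entries indexed by [nat], which simplification unfolds to an explicit
    expression for concrete [n]. *)
Fixpoint laplace_det {R : comNzRingType} n (F : nat -> nat -> R) : R :=
  if n is n'.+1 then
    foldr (fun j s =>
      F 0 j * ((-1) ^+ j * laplace_det n' (fun i k => F i.+1 (bump j k))) + s)
      0 (iota 0 n)
  else 1.

Lemma det_mx_nat (R : comNzRingType) n (F : nat -> nat -> R) :
  \det (\matrix_(i < n, j < n) F i j) = laplace_det n F.
Proof.
elim: n F => [|n IH] F; first exact: det_mx00.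
rewrite det_mx_nat_recl.
under eq_bigr => j _ do rewrite (IH (fun i k => F i.+1 (bump j k))).
rewrite -(big_mkord xpredT (fun j => F 0 j * ((-1) ^+ j *
  laplace_det n (fun i k => F i.+1 (bump j k))))) /index_iota subn0.
by rewrite unlock.
Qed.

(** As [3 != 0], the derivative has degree exactly 2, the Sylvester matrix is 5 by 5, and its
    determinant can be expanded. *)
Lemma discr_cubic (A : idomainType) (b c d : A) : 3 != 0 :> A ->
  discr ('X^3 + b *: 'X^2 + c *: 'X + d%:P) =
  b ^+ 2 * c ^+ 2 - 4 * c ^+ 3 - 4 * b ^+ 3 * d - 27 * d ^+ 2 + 18 * b * c * d.
Proof.
move=> neq0_3; set p := (X in discr X).
have pE : p = Poly [:: d; c; b; 1].
  by apply/polyP => -[|[|[|[|i]]]]; rewrite coef_Poly !coefE /= ?nth_nil; ring.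
have sp : size p = 4%N by rewrite pE (@PolyK _ 0) //= oner_neq0.
have dpE : p^`() = Poly [:: c; b *+ 2; 3].
  by rewrite pE; apply/polyP => -[|[|[|i]]];
    rewrite coef_deriv !coef_Poly /= ?nth_nil ?mul0rn.
have sdp : size p^`() = 3%N by rewrite dpE (@PolyK _ 0).
have lp : lead_coef p = 1 by rewrite lead_coefE sp pE coef_Poly.
rewrite /discr lp divr1 sp (@resultant_mxE _ _ _ 3 2) // dpE pE.
pose F (i j : nat) : A :=
  if (i < 2)%N then [:: d; c; b; 1]`_(j - i) *+ (i <= j)
  else [:: c; b *+ 2; 3]`_(j - (i - 2)) *+ (i - 2 <= j).
rewrite (_ : \matrix_(i, j) _ = \matrix_(i < 5, j < 5) F i j); last first.
  by apply/matrixP => i j; rewrite !mxE !coef_Poly.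
rewrite det_mx_nat /F /bump /=.
ring.
Qed.

(** * The polynomial and its vanishing *)

(* 16 times the discriminant of z^3 + s1 z^2 + (s2 - x/4) z + s3, in the
   variable x. *)
Definition heron_poly {A : comNzRingType} (s1 s2 s3 : A) : {poly A} :=
  'X^3 + (s1 ^+ 2 - 12 * s2) *: 'X^2
  + (48 * s2 ^+ 2 - 8 * s1 ^+ 2 * s2 - 72 * s1 * s3) *: 'X
  + (16 * s1 ^+ 2 * s2 ^+ 2 - 64 * s2 ^+ 3 + 288 * s1 * s2 * s3
     - 64 * s1 ^+ 3 * s3 - 432 * s3 ^+ 2)%:P.

Section HeronPoly.
Context {A : comNzRingType} (s1 s2 s3 : A).

(** The shifted variable [x - 4 * s2] is -4 times the coefficient [s2 - x/4] of z; in it the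
    discriminant keeps its five terms. *)
Lemma heron_polyE x : (heron_poly s1 s2 s3).[x] =
  (x - 4 * s2) ^+ 3 + s1 ^+ 2 * (x - 4 * s2) ^+ 2
  - 72 * s1 * s3 * (x - 4 * s2) - 64 * s1 ^+ 3 * s3 - 432 * s3 ^+ 2.
Proof.
by rewrite /heron_poly !(hornerD, hornerZ, hornerXn, hornerX, hornerC); ring.
Qed.

Lemma size_heron_poly : size (heron_poly s1 s2 s3) = 4%N.
Proof.
rewrite /heron_poly -!addrA size_polyDl size_polyXn //.
rewrite (leq_ltn_trans (size_polyD _ _)) // gtn_max.
rewrite (leq_ltn_trans (size_scale_leq _ _)) ?size_polyXn //=.
rewrite (leq_ltn_trans (size_polyD _ _)) // gtn_max.
rewrite (leq_ltn_trans (size_scale_leq _ _)) ?size_polyX //=.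
by rewrite (leq_ltn_trans (size_polyC_leq1 _)).
Qed.

Lemma monic_heron_poly : heron_poly s1 s2 s3 \is monic.
Proof.
apply/monicP; rewrite lead_coefE size_heron_poly /heron_poly.
by rewrite !coefE /= !mulr0 !addr0.
Qed.

Lemma map_heron_poly (B : comNzRingType) (f : {rmorphism A -> B}) :
  map_poly f (heron_poly s1 s2 s3) = heron_poly (f s1) (f s2) (f s3).
Proof.
rewrite /heron_poly !rmorphD /= !map_polyZ /= !map_polyXn map_polyX !map_polyC /=.
by rewrite !(rmorphD f, rmorphN f, rmorphM f, rmorphXn f, rmorph_nat f).
Qed.

End HeronPoly.

(* The Gram determinant of the position vectors p, q, s of the vertices of the
   polygon p, -p, q, s vanishes and divides the value of the polynomial. *)
Lemma heron_poly_quad {R : realFieldType} {c d x0 x1 x2 x3 y0 y1 y2 y3 r : R} :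
  (x0 - c) ^+ 2 + (y0 - d) ^+ 2 = r ->
  (x2 - c) ^+ 2 + (y2 - d) ^+ 2 = r ->
  (x3 - c) ^+ 2 + (y3 - d) ^+ 2 = r ->
  x0 + x1 = c *+ 2 -> y0 + y1 = d *+ 2 ->
  let u := (x1 - x2) ^+ 2 + (y1 - y2) ^+ 2 in
  let v := (x2 - x3) ^+ 2 + (y2 - y3) ^+ 2 in
  let w := (x3 - x0) ^+ 2 + (y3 - y0) ^+ 2 in
  let K := (x0 + x1) / 2 * (y1 - y0) + (x1 + x2) / 2 * (y2 - y1)
    + (x2 + x3) / 2 * (y3 - y2) + (x3 + x0) / 2 * (y0 - y3) in
  (heron_poly (u + v + w) (u * v + u * w + v * w) (u * v * w)).[16 * K ^+ 2] = 0.
Proof.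
move=> e0 e2 e3 ex ey.
have {ex} -> : x1 = c *+ 2 - x0 by rewrite -ex; ring.
have {ey} -> : y1 = d *+ 2 - y0 by rewrite -ey; ring.
move=> u v w K.
(* Seen from the centre the vertices are p, -p, q, s; [a], [b], [g] are the inner products pq, qs,
   sp, and [r] is the squared radius. *)
pose a := (x0 - c) * (x2 - c) + (y0 - d) * (y2 - d).
pose b := (x2 - c) * (x3 - c) + (y2 - d) * (y3 - d).
pose g := (x3 - c) * (x0 - c) + (y3 - d) * (y0 - d).
have uE : u = 2 * (r + a).
  have -> : 2 * (r + a) = r + r + 2 * a by ring.
  by rewrite -{1}e0 -e2 /u /a; ring.
have vE : v = 2 * (r - b).
  have -> : 2 * (r - b) = r + r - 2 * b by ring.
  by rewrite -{1}e2 -e3 /v /b; ring.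
have wE : w = 2 * (r - g).
  have -> : 2 * (r - g) = r + r - 2 * g by ring.
  by rewrite -{1}e0 -e3 /w /g; ring.
(* Cross products of q and p, of q and s, of s and p. Their pairwise products reduce to inner
   products by the Binet-Cauchy identity. *)
pose X := (x2 - c) * (y0 - d) - (y2 - d) * (x0 - c).
pose Y := (x2 - c) * (y3 - d) - (y2 - d) * (x3 - c).
pose Z := (x3 - c) * (y0 - d) - (y3 - d) * (x0 - c).
have KE : 2 * K = X + Y + Z by rewrite /K /X /Y /Z; field.
have XX : X ^+ 2 = r ^+ 2 - a ^+ 2 by rewrite [r ^+ 2]expr2 -{1}e0 -e2 /X /a; ring.
have YY : Y ^+ 2 = r ^+ 2 - b ^+ 2 by rewrite [r ^+ 2]expr2 -{1}e2 -e3 /Y /b; ring.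
have ZZ : Z ^+ 2 = r ^+ 2 - g ^+ 2 by rewrite [r ^+ 2]expr2 -{1}e0 -e3 /Z /g; ring.
have XY : X * Y = r * g - a * b by rewrite -e2 /X /Y /a /b /g; ring.
have XZ : X * Z = r * b - a * g by rewrite -e0 /X /Z /a /b /g; ring.
have YZ : Y * Z = b * g - r * a by rewrite -e3 /Y /Z /a /b /g; ring.
have KK : 16 * K ^+ 2 = 4 * (3 * r ^+ 2 - a ^+ 2 - b ^+ 2 - g ^+ 2
    + 2 * (r * g - a * b + r * b - a * g + b * g - r * a)).
  have -> : 16 * K ^+ 2 = 4 * (2 * K) ^+ 2 by ring.
  rewrite KE; transitivity (4 * (X ^+ 2 + Y ^+ 2 + Z ^+ 2
      + 2 * (X * Y + X * Z + Y * Z))); first by ring.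
  by rewrite XX YY ZZ XY XZ YZ; ring.
have gram : r ^+ 3 + 2 * a * b * g - r * (a ^+ 2 + b ^+ 2 + g ^+ 2) = 0.
  (* The Gram determinant is [Y * (r * Y + a * Z - g * X)], whose second factor is the inner product
     with p of the vanishing combination [Y] p + [Z] q - [X] s. *)
  have -> : r ^+ 3 + 2 * a * b * g - r * (a ^+ 2 + b ^+ 2 + g ^+ 2) =
    r * (r ^+ 2 - b ^+ 2) - a * (a * r - b * g) - g * (g * r - a * b) by ring.
  have -> : a * r - b * g = - (Y * Z) by rewrite YZ; ring.
  have -> : g * r - a * b = X * Y by rewrite XY; ring.
  by rewrite -YY -e0 /X /Y /Z /a /g; ring.
rewrite heron_polyE KK uE vE wE.
(* The sides are [2 * (r - t)] for t = [- a], [b], [g], and the area term is symmetric in these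
   three, so the cofactor is written in their elementary symmetric functions. *)
transitivity (256 * (- 54 * r ^+ 3 - 27 * r ^+ 2 * (b + g - a)
    + 18 * r * ((b + g - a) ^+ 2 - 3 * (b * g - a * b - a * g))
    - (b + g - a) ^+ 3 - 54 * (a * b * g)) *
  (r ^+ 3 + 2 * a * b * g - r * (a ^+ 2 + b ^+ 2 + g ^+ 2))); first by ring.
by rewrite gram mulr0.
Qed.

(** * Elementary symmetric polynomials in three variables *)

(** The sets of n among n+1 indices are the complements of singletons. *)
Lemma mesym_corank1E n (R : comNzRingType) :
  mesym n.+1 R n = \sum_i \prod_(j | j != i) 'X_j.
Proof.
rewrite mesymE (reindex (fun i : 'I_n.+1 => ~: [set i])) /=; last first.
  exists (fun h : {set 'I_n.+1} => odflt ord0 [pick i | i \notin h]) => [i _|h].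
    case: pickP => [j|/(_ i)]; last by rewrite !inE eqxx.
    by rewrite !inE negbK => /eqP.
  rewrite inE => /eqP card_h; have /eqP/cards1P[i hE] : #|~: h| = 1%N.
    by apply/eqP; rewrite -(eqn_add2l #|h|) cardsC card_ord card_h addn1.
  case: pickP => [j|/(_ i)] /=; last by rewrite -in_setC hE inE eqxx.
  by rewrite -in_setC hE inE => /eqP ->; rewrite -hE setCK.
apply: eq_big => [i|i _]; first by rewrite cardsC1 card_ord eqxx.
rewrite -mmap1_id /mmap1 [RHS]big_mkcond; apply: eq_bigr => j _.
by rewrite mnmE !inE; case: (j == i).
Qed.

Section ThreeVariables.
Context {R S : comNzRingType} (f : {rmorphism R -> S}) (h : 'I_3 -> S).

Lemma mmap_mesym3 :
  let x := h (inord 0) in let y := h (inord 1) in let z := h (inord 2) in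
  [/\ mmap f h (mesym 3 R 1) = x + y + z,
      mmap f h (mesym 3 R 2) = x * y + x * z + y * z &
      mmap f h (mesym 3 R 3) = x * y * z].
Proof.
move=> x y z; have o0 : ord0 = inord 0 :> 'I_3 by apply: val_inj; rewrite /= inordK.
have o1 : lift ord0 ord0 = inord 1 :> 'I_3 by apply: val_inj; rewrite /= inordK.
have o2 : lift ord0 (lift ord0 ord0) = inord 2 :> 'I_3.
  by apply: val_inj; rewrite /= inordK.
have mX i : mmap f h 'X_i = h i by rewrite mmapX mmap1U.
have mD : {morph mmap f h : p q / p + q} by exact: rmorphD.
have mM : {morph mmap f h : p q / p * q} by exact: rmorphM.
have m0 : mmap f h 0 = 0 by exact: rmorph0.
have m1 : mmap f h 1 = 1 by exact: rmorph1.
split; rewrite ?mesym1E ?mesymnnE ?mesym_corank1E.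
- by rewrite !big_ord_recl big_ord0 /= !mD m0 !mX o2 o1 o0 addr0 addrA.
- under eq_bigr do rewrite big_mkcond /=.
  by rewrite !big_ord_recl !big_ord0 /= !(mD, mM, m0, m1, mX) o2 o1 o0 /x /y /z; ring.
by rewrite !big_ord_recl big_ord0 /= !mM m1 !mX o2 o1 o0 mulr1 mulrA.
Qed.

End ThreeVariables.

(** * The polynomial in four variables and the substitution of u2 *)

Definition heron_mpoly : {mpoly int[4]} :=
  munsplit (heron_poly (mesym 3 int 1) (mesym 3 int 2) (mesym 3 int 3)).

Lemma in_u2X n (m : 'X_{1..n.+1}) :
  in_u2 'X_[m] = (-4) ^+ m ord0 *: ('X_[m] : {mpoly int[n.+1]}).
Proof.
rewrite /in_u2 comp_mpolyX big_ord_recl tnth_mktuple eqxx exprMn -mulrA.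
rewrite (mpolyXE_id _ m) [in RHS]big_ord_recl -mul_mpolyC; congr (_ * (_ * _)).
  by rewrite rmorphXn rmorphN /= rmorph_nat.
by apply: eq_bigr => j _; rewrite tnth_mktuple.
Qed.

Lemma mcoeff_in_u2 n (P : {mpoly int[n.+1]}) m :
  (in_u2 P)@_m = (-4) ^+ m ord0 * P@_m.
Proof.
rewrite {1}(mpolyE P) /in_u2 (raddf_sum (comp_mpoly _)) raddf_sum /=.
rewrite {3}(mpolyE P) raddf_sum mulr_sumr; apply: eq_bigr => m' _ /=.
rewrite comp_mpolyZ -/(in_u2 _) in_u2X !mcoeffZ mcoeffX.
by case: eqP => [->|_]; rewrite ?mulr0 // mulrCA.
Qed.

(** Each coefficient is only scaled by a power of -4, which is nonzero though not invertible in the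
    integers. *)
Lemma in_u2_inj n : injective (@in_u2 n).
Proof.
move=> P Q PQ; apply/mpolyP => m; apply: (@mulfI _ ((-4) ^+ m ord0)).
  by rewrite expf_neq0.
by rewrite -!mcoeff_in_u2 PQ.
Qed.

Lemma in_u2_lift n (p : {mpoly int[n]}) : in_u2 (mlift p) = mlift p.
Proof.
apply/mpolyP => m; rewrite mcoeff_in_u2 (mcons_tail _ m) -msplitE.
rewrite msplit_lift coefC mcons0; case: (m ord0) => [|k] /=.
  by rewrite mul1r.
by rewrite mcoeff0 mulr0.
Qed.

Lemma heron_mpolyE :
  heron_mpoly = (heron_poly (sigma 1) (sigma 2) (sigma 3)).['X_ord0].
Proof. by rewrite /heron_mpoly /munsplit map_heron_poly. Qed.

Lemma in_u2_heron :
  in_u2 heron_mpoly = 16 * discr ('X^3 + sigma 1 *: 'X^2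
    + (sigma 2 + 'X_ord0) *: 'X + (sigma 3)%:P).
Proof.
rewrite discr_cubic; last first.
  by rewrite -(rmorph_nat (@mpolyC 4 int)) mpolyC_eq0.
rewrite heron_mpolyE.
have u2s k : @in_u2 3 (sigma k) = sigma k by exact: in_u2_lift.
have u20 : in_u2 'X_ord0 = -4 * 'X_ord0 :> {mpoly int[4]}.
  by rewrite in_u2X mnm1E eqxx expr1 -mul_mpolyC rmorphN /= rmorph_nat.
rewrite {1}/in_u2 -horner_map map_heron_poly heron_polyE /= -!/(in_u2 _) u20 !u2s.
move: (sigma 1) (sigma 2) (sigma 3) 'X_ord0 => s1 s2 s3 u; ring.
Qed.

Lemma msplit_heron : msplit heron_mpoly =
  heron_poly (mesym 3 int 1) (mesym 3 int 2) (mesym 3 int 3).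
Proof. exact: munsplitK. Qed.

Lemma mmap_heron (S : comNzRingType) (h : 'I_4 -> S) :
  let u := h (inord 1) in let v := h (inord 2) in let w := h (inord 3) in
  mmap intr h heron_mpoly =
  (heron_poly (u + v + w) (u * v + u * w + v * w) (u * v * w)).[h ord0].
Proof.
move=> u v w; rewrite mmap_msplit msplit_heron map_heron_poly /=.
have [-> -> ->] := mmap_mesym3 intr (h \o lift ord0).
suff lE k : (k < 3)%N -> lift ord0 (inord k : 'I_3) = inord k.+1 by rewrite /= !lE.
by move=> k3; apply: val_inj; rewrite /= !inordK.
Qed.

(** * Vanishing on semicyclic quadrilaterals *)

Lemma dist_sqr {R : realType} (p q : R * R) :
  dist p q ^+ 2 = (p.1 - q.1) ^+ 2 + (p.2 - q.2) ^+ 2.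
Proof. by rewrite sqr_sqrtr // addr_ge0 ?sqr_ge0. Qed.

Lemma heron_vanishes (R : realType) : vanishes_on_semicyclic R heron_mpoly.
Proof.
move=> v i [[c d] [r [[_ vr] vc]]].
have on_circle k : ((v k).1 - c) ^+ 2 + ((v k).2 - d) ^+ 2 = r ^+ 2.
  by rewrite -(vr k) dist_sqr /= -(opprB c) -(opprB d) !sqrrN.
pose o k : 'I_4 := inord k.
have oS k : (k < 4)%N -> ordS (o k) = o (k.+1 %% 4)%N.
  by move=> k4; apply: val_inj; rewrite /= !inordK // ltn_mod.
have oE : [/\ ord0 = o 0, lift ord0 ord0 = o 1, lift ord0 (lift ord0 ord0) = o 2
             & lift ord0 (lift ord0 (lift ord0 ord0)) = o 3 :> 'I_4].
  by split; apply: val_inj; rewrite /= inordK.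
have areaE : signed_area v =
    ((v (o 0)).1 + (v (o 1)).1) / 2 * ((v (o 1)).2 - (v (o 0)).2)
  + ((v (o 1)).1 + (v (o 2)).1) / 2 * ((v (o 2)).2 - (v (o 1)).2)
  + ((v (o 2)).1 + (v (o 3)).1) / 2 * ((v (o 3)).2 - (v (o 2)).2)
  + ((v (o 3)).1 + (v (o 0)).1) / 2 * ((v (o 0)).2 - (v (o 3)).2).
  case: oE => e0 e1 e2 e3.
  rewrite /signed_area !big_ord_recl big_ord0 e3 e2 e1 e0 !oS //.
  by rewrite addr0 !addrA.
have liftE k l m : (k < 4)%N -> (l < 3)%N -> m = bump k l ->
    lift (o k) (inord l : 'I_3) = o m.
  move=> k4 l3 ->; apply: val_inj; rewrite /= !inordK //.
  by rewrite /bump; case: (k <= l)%N; rewrite ?add0n // ltnW.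
have areaptE k : (k < 3)%N ->
    area_point v i (inord k.+1) = side_length v (lift i (inord k)) ^+ 2.
  move=> k3; rewrite /area_point.
  rewrite (_ : inord k.+1 = lift ord0 (inord k : 'I_3)) ?liftK //.
  by apply: val_inj; rewrite /= !inordK.
have area0 : area_point v i ord0 = 16 * signed_area v ^+ 2.
  by rewrite /area_point unlift_none.
(* A cyclic shift of the vertices brings the diameter to side 0, the case of [heron_poly_quad]; the
   symmetric functions absorb the reordering of the sides. *)
have [iE|iE|iE|iE] : [\/ i = o 0, i = o 1, i = o 2 | i = o 3].
  by case: (i) => [[|[|[|[|]]]] ?] //;
    [apply: Or41|apply: Or42|apply: Or43|apply: Or44];
    apply: val_inj; rewrite /= inordK.
all: move: vc; rewrite mmap_heron area0 !areaptE // iE areaE.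
all: rewrite ?(liftE 0 0 1)%N ?(liftE 0 1 2)%N ?(liftE 0 2 3)%N //.
all: rewrite ?(liftE 1 0 0)%N ?(liftE 1 1 2)%N ?(liftE 1 2 3)%N //.
all: rewrite ?(liftE 2 0 0)%N ?(liftE 2 1 1)%N ?(liftE 2 2 3)%N //.
all: rewrite ?(liftE 3 0 0)%N ?(liftE 3 1 1)%N ?(liftE 3 2 2)%N //.
all: rewrite /side_length !oS //= !dist_sqr.
all: move: (on_circle (o 0)) (on_circle (o 1)) (on_circle (o 2)) (on_circle (o 3)).
all: case: (v (o 0)) => x0 y0; case: (v (o 1)) => x1 y1.
all: case: (v (o 2)) => x2 y2; case: (v (o 3)) => x3 y3 /=.
all: move=> r0 r1 r2 r3 [ex ey].
- by have := heron_poly_quad r0 r2 r3 ex ey.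
- by rewrite -(heron_poly_quad r1 r3 r0 ex ey); congr (heron_poly _ _ _).[_]; ring.
- by rewrite -(heron_poly_quad r2 r0 r1 ex ey); congr (heron_poly _ _ _).[_]; ring.
by rewrite -(heron_poly_quad r3 r1 r2 ex ey); congr (heron_poly _ _ _).[_]; ring.
Qed.

(** * Monicity and homogeneity *)

Lemma heron_monic : monic_in_first heron_mpoly.
Proof.
pose p := heron_poly (mesym 3 int 1) (mesym 3 int 2) (mesym 3 int 3).
have p3 : p`_3 = 1.
  by have /monicP := monic_heron_poly (mesym 3 int 1) (mesym 3 int 2) (mesym 3 int 3);
    rewrite lead_coefE size_heron_poly.
have U3 : (U_(ord0) *+ 3%N)%MM = mcons 3 0%MM :> 'X_{1..4}.
  apply/mnmP => j; rewrite mulmnE mnm1E; case: (unliftP ord0 j) => [k|] ->.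
    by rewrite mconsS mnm0E.
  by rewrite mcons0.
exists 3%N; rewrite U3; split.
  by rewrite -msplitE msplit_heron -/p p3 mcoeff1 eqxx.
move=> m; rewrite (mcons_tail _ m); move: (m ord0) [multinom _ | _ < _] => k {}m.
rewrite mcoeff_msupp -msplitE msplit_heron -/p mcons0.
have [//|k3|->] := ltngtP k 3%N.
  by rewrite nth_default ?mcoeff0 ?eqxx // size_heron_poly.
rewrite p3 mcoeff1.
by case: (m =P 0%MM) => [->|_]; rewrite eqxx.
Qed.

Lemma area_weight_cons n k (m : 'X_{1..n}) :
  area_weight (mcons k m) = (2 * k + mdeg m)%N.
Proof.
rewrite /area_weight mcons0 mdegE; congr (_ + _)%N.
by apply: eq_bigr => j _; rewrite mconsS.
Qed.

Lemma mlift_homog n d (p : {mpoly int[n]}) :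
  p \is d.-homog -> mlift p \is d.-homog for (@area_weight n).
Proof.
move=> /dhomogP hp; apply/dhomogP => m; rewrite mcoeff_msupp (mcons_tail _ m).
rewrite -msplitE msplit_lift coefC; case: (m ord0) => [|k] /=; last first.
  by rewrite mcoeff0 eqxx.
by rewrite -mcoeff_msupp => /hp <-; rewrite area_weight_cons.
Qed.

(** Both [16 K^2] and [sigma 2] have weight 2, so every term of the shifted form [heron_polyE] has
    weight 6. *)
Lemma heron_homog : heron_mpoly \is ishomog (@area_weight 3).
Proof.
apply/homogP; exists 6%N.
have homS k : (sigma k : {mpoly int[4]}) \is k.-homog for (@area_weight 3).
  exact/mlift_homog/dhomog_mesym.
have homX : ('X_ord0 : {mpoly int[4]}) \is 2.-homog for (@area_weight 3).
  rewrite dhomogX /= /area_weight mnm1E eqxx big1 // => j _.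
  by rewrite mnm1E.
have homN k : (k%:R : {mpoly int[4]}) \is 0.-homog for (@area_weight 3).
  by rewrite rpredMn // dhomog1.
have homM := @dhomogM 4 int (@area_weight 3).
rewrite heron_mpolyE heron_polyE.
have homY : ('X_ord0 - 4 * sigma 2 : {mpoly int[4]}) \is 2.-homog for (@area_weight 3).
  by rewrite rpredB // (homM 0 _ 2).
have homXn d (p : {mpoly int[4]}) k : p \is d.-homog for (@area_weight 3) ->
   p ^+ k \is (d * k).-homog for (@area_weight 3) by exact: dhomogMn.
rewrite rpredB ?rpredB ?rpredD //.
- exact: (homXn 2 _ 3).
- by apply: (homM (1 * 2) _ (2 * 2)); apply: homXn.
- by apply: (homM 4 _ 2) => //; apply: (homM 1 _ 3) => //; apply: (homM 0 _ 1).
- by apply: (homM 3 _ 3) => //; apply: (homM 0 _ (1 * 3)) => //; apply: homXn.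
by apply: (homM 0 _ (3 * 2)) => //; apply: homXn.
Qed.

(** * Irreducibility *)

Lemma intr_Fp_eq0 p (n : int) : prime p -> (n%:~R == 0 :> 'F_p) = (p %| `|n|)%N.
Proof.
move=> p_pr; rewrite (dvdn_pcharf (pchar_Fp p_pr)).
by case: n => n //; rewrite NegzE mulrNz oppr_eq0.
Qed.

(* For s1 = s2 = s3 = 1 the polynomial is [x ^+ 3 - x ^+ 2 - 2 * x - 1] modulo 5,
   which has no root. *)
Lemma heron_no_rat_root (s1 s2 s3 : int) (x : rat) :
  s1%:~R = 1 :> 'F_5 -> s2%:~R = 1 :> 'F_5 -> s3%:~R = 1 :> 'F_5 ->
  (heron_poly s1%:~R s2%:~R s3%:~R).[x] != 0.
Proof.
move=> s15 s25 s35; apply/eqP => root_x.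
have d0 : (denq x)%:~R != 0 :> rat by rewrite intr_eq0 denq_neq0.
(* The cubic homogenized at x = n/d: its integer value can be reduced modulo 5 even if 5 divides the
   denominator. *)
pose N (A : comNzRingType) (t1 t2 t3 n d : A) :=
  (n - 4 * t2 * d) ^+ 3 + t1 ^+ 2 * (n - 4 * t2 * d) ^+ 2 * d
  - 72 * t1 * t3 * (n - 4 * t2 * d) * d ^+ 2
  - (64 * t1 ^+ 3 * t3 + 432 * t3 ^+ 2) * d ^+ 3.
have N_morph (B A : comNzRingType) (f : {rmorphism B -> A}) t1 t2 t3 n d :
    f (N _ t1 t2 t3 n d) = N A (f t1) (f t2) (f t3) (f n) (f d).
  rewrite /N.
  by rewrite !(rmorphD f, rmorphN f, rmorphM f, rmorphXn f, rmorph_nat f).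
have N0 : N _ s1 s2 s3 (numq x) (denq x) = 0.
  apply/eqP; rewrite -(intr_eq0 rat); apply/eqP.
  transitivity ((heron_poly s1%:~R s2%:~R s3%:~R).[((numq x)%:~R / (denq x)%:~R : rat)]
    * (denq x)%:~R ^+ 3); last by rewrite divq_num_den root_x mul0r.
  rewrite (N_morph int rat intr) heron_polyE /N /=.
  move: (numq x) (denq x) d0 => n d d0.
  by field.
(* The form has no nontrivial zero modulo 5 (25 pairs to check), so 5 would divide both numerator
   and denominator of [x]. *)
have NF (n d : 'F_5) : N _ 1 1 1 n d = 0 -> (n == 0) && (d == 0).
  have F5 : 5 = 0 :> 'F_5 by exact/val_inj.
  have -> : N _ 1 1 1 n d = n ^+ 3 - n ^+ 2 * d - 2 * n * d ^+ 2 - d ^+ 3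
      - 5 * (2 * n ^+ 2 * d + 6 * n * d ^+ 2 + 51 * d ^+ 3) by rewrite /N; ring.
  rewrite F5 mul0r subr0.
  by case: n d => [[|[|[|[|[|]]]]] ?] // [[|[|[|[|[|]]]]] ?].
have : N _ s1%:~R s2%:~R s3%:~R (numq x)%:~R (denq x)%:~R = 0 :> 'F_5.
  by rewrite -(N_morph int 'F_5 intr) N0.
rewrite s15 s25 s35 => /NF; rewrite !intr_Fp_eq0 // => /andP[n5 d5].
have := coprime_num_den x; rewrite /coprime => /eqP g1.
by have := dvdn_gcd 5 `|numq x| `|denq x|; rewrite g1 n5 d5.
Qed.

(** As the cubic is monic, leading coefficients of factors are units: a factor of degree 0 is a
    unit, and one of degree 1 would give a root among the polynomials in the side squares. *)
Lemma heron_irreducible : irreducible_elt heron_mpoly.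
Proof.
set H := heron_poly (mesym 3 int 1) (mesym 3 int 2) (mesym 3 int 3).
have splitH : msplit heron_mpoly = H := msplit_heron.
have szH : size H = 4%N by exact: size_heron_poly.
have no_root (x : {mpoly int[3]}) : H.[x] != 0.
  (* At side squares (1, 2, 3) the elementary symmetric functions are 6, 11, 6, all 1 modulo 5. *)
  pose h (k : 'I_3) : rat := k.+1%:R.
  apply/eqP => /(congr1 (mmap intr h)).
  rewrite rmorph0 -horner_map map_heron_poly /=.
  have [-> -> ->] := mmap_mesym3 intr h; rewrite /h !inordK //.
  apply/eqP.
  rewrite (_ : 1 + _ + _ = 6%:~R) // (_ : 1 * _ + _ + _ = 11%:~R) //.
  rewrite (_ : 1 * _ * _ = 6%:~R) //.
  by apply: heron_no_rat_root; apply/val_inj.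
have lead_mul (a b : {poly {mpoly int[3]}}) :
    a * b = H -> lead_coef a * lead_coef b = 1.
  move=> ab; rewrite -lead_coefM ab; apply/monicP; exact: monic_heron_poly.
have unit_of_factor (a b : {poly {mpoly int[3]}}) :
    a * b = H -> size a = 1%N -> a \is a GRing.unit.
  move=> ab sza; have := lead_mul _ _ ab; rewrite [lead_coef a]lead_coefE sza => lab.
  rewrite poly_unitE sza eqxx; apply/unitrPr; by exists (lead_coef b).
have unit_msplit (a : {mpoly int[4]}) : msplit a \is a GRing.unit -> a \is a GRing.unit.
  move=> /unitrPr [b ab]; apply/unitrPr; exists (munsplit b).
  by apply: msplit_inj; rewrite rmorphM rmorph1 /= munsplitK.
have no_linear_factor (a b : {poly {mpoly int[3]}}) : a * b = H -> size a != 2%N.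
  move=> ab; apply/eqP => sza.
  have lab : a`_1 * lead_coef b = 1.
    by have := lead_mul _ _ ab; rewrite [lead_coef a]lead_coefE sza.
  (* [lead_coef b] is the inverse of the leading coefficient of [a], so this is the root of the
     linear factor. *)
  have /eqP[] := no_root (- a`_0 * lead_coef b); rewrite -ab hornerM.
  rewrite [a.[_]]horner_coef sza !big_ord_recl big_ord0 /= expr0 expr1.
  by rewrite /bump /= mulr1 addr0 mulrCA lab mulr1 addrN mul0r.
split.
- apply/eqP => /(congr1 msplit); rewrite msplit_heron rmorph0 -/H => H0.
  by move: szH; rewrite H0 size_poly0.
- apply/negP => /unitrPr [b hb].
  have : H \is a GRing.unit; last by rewrite poly_unitE szH.
  apply/unitrPr; exists (msplit b).
  have -> : H * msplit b = msplit (heron_mpoly * b).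
    by rewrite -splitH; apply/esym/(rmorphM msplit).
  by rewrite hb; exact: (rmorph1 msplit).
move=> a b hab; have ab : msplit a * msplit b = H.
  by rewrite -splitH hab; apply/esym/(rmorphM msplit).
suff [|] : msplit a \is a GRing.unit \/ msplit b \is a GRing.unit.
- by move=> /unit_msplit; left.
- by move=> /unit_msplit; right.
move: (msplit a) (msplit b) ab => {hab} {}a {}b ab.
have [a0 b0] : a != 0 /\ b != 0.
  by split; apply: contraPneq szH => e; rewrite -ab e ?mul0r ?mulr0 size_poly0.
have ba : b * a = H by rewrite mulrC.
have := size_mul a0 b0; rewrite ab szH.
have := no_linear_factor _ _ ab; have := no_linear_factor _ _ ba.
move: a0 b0; rewrite -!size_poly_gt0.
have := unit_of_factor _ _ ab; have := unit_of_factor _ _ ba.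
(* The sizes of the factors, degrees plus one, add up to 5. *)
case: (size a) => [|[|[|[|[|k]]]]] //.
- by move=> _ h; left; apply: h.
- by case: (size b) => [|[|[|]]].
- by case: (size b) => [|[|[|]]] // h; right; apply: h.
by case: (size b) => [|n] //; rewrite addnS.
Qed.

(** * Uniqueness *)

(* With d the diameter and a, b, c the other sides, the last equation is
   equivalent to Ptolemy's (d^2 - a^2)(d^2 - c^2) = (b d + a c)^2. *)
Lemma diameter_exists (R : rcfType) (a b c : R) : 0 < a -> 0 < b -> 0 < c ->
  exists d, [/\ 0 < d, a ^+ 2 <= d ^+ 2, c ^+ 2 <= d ^+ 2 &
    d ^+ 3 = (a ^+ 2 + b ^+ 2 + c ^+ 2) * d + 2 * a * b * c].
Proof.
move=> a0 b0 c0.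
have abc0 : 0 < a * b * c by rewrite !mulr_gt0.
have ab0 : 0 < a * b by rewrite mulr_gt0.
have ac0 : 0 < a * c by rewrite mulr_gt0.
have bc0 : 0 < b * c by rewrite mulr_gt0.
pose s := a ^+ 2 + b ^+ 2 + c ^+ 2.
have a20 : 0 < a ^+ 2 by rewrite exprn_gt0.
have b20 : 0 < b ^+ 2 by rewrite exprn_gt0.
have c20 : 0 < c ^+ 2 by rewrite exprn_gt0.
have s0 : 0 < s by rewrite /s !addr_gt0.
have l0 : 0 < Num.sqrt s by rewrite sqrtr_gt0.
have l2 : Num.sqrt s ^+ 2 = s by rewrite sqr_sqrtr ?ltW.
pose p : {poly R} := 'X^3 - s *: 'X - (2 * a * b * c)%:P.
have pE x : p.[x] = x ^+ 3 - s * x - 2 * a * b * c.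
  by rewrite /p !(hornerD, hornerN, hornerZ, hornerXn, hornerX, hornerC).
have lM : Num.sqrt s <= a + b + c.
  have M0 : 0 <= a + b + c by rewrite !addr_ge0 ?ltW.
  rewrite -(@ler_pXn2r _ 2) ?nnegrE ?sqrtr_ge0 //.
  rewrite l2 /s -subr_ge0 (_ : _ - _ = 2 * (a * b + a * c + b * c)); last by ring.
  by rewrite mulr_ge0 // !addr_ge0 ?ltW.
(* The cubic is negative at the square root of [s] and nonnegative at [a + b + c]. A root beyond the
   former has square at least [s], which gives both inequalities. *)
have [|x /andP[lx _] /rootP] := @poly_ivt _ p _ _ lM.
  rewrite !pE; apply/andP; split.
    rewrite exprS l2 [_ * s]mulrC subrr sub0r oppr_le0 -!mulrA mulr_ge0 //.
    by rewrite mulrA ltW.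
  rewrite /s (_ : _ - _ = 2 * (a ^+ 2 * b + a ^+ 2 * c + b ^+ 2 * a + b ^+ 2 * c
    + c ^+ 2 * a + c ^+ 2 * b + 2 * (a * b * c))); last by ring.
  by rewrite !(mulr_ge0, addr_ge0) // ltW.
rewrite pE => px0; exists x; have x0 : 0 < x by exact: lt_le_trans lx.
have x2 : s <= x ^+ 2 by rewrite -l2 ler_pXn2r ?nnegrE ?sqrtr_ge0 // ltW.
split=> //.
- by apply: le_trans x2; rewrite /s -addrA lerDl addr_ge0 ?ltW.
- by apply: le_trans x2; rewrite /s lerDr addr_ge0 ?ltW.
by apply/eqP; rewrite -/s -subr_eq0 opprD addrA px0.
Qed.

(** By Thales, the first and third sides are legs of right triangles with the diameter [d] as
    hypotenuse; the other legs [S] and [T] are the diagonals. Ptolemy's relation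
    [S * T = b * d + a * c] then forces the middle side. *)
Lemma semicyclic_quad_exists (R : realType) (u v w : R) :
  0 < u -> 0 < v -> 0 < w ->
  exists (q : 'I_4 -> R * R) (i : 'I_4), semicyclic_at q i /\
    forall k : 'I_3, area_point q i (lift ord0 k) = [:: u; v; w]`_k.
Proof.
move=> u0 v0 w0.
have [||| d [d0]] := @diameter_exists R (Num.sqrt u) (Num.sqrt v) (Num.sqrt w).
- by rewrite sqrtr_gt0.
- by rewrite sqrtr_gt0.
- by rewrite sqrtr_gt0.
have [a0 b0 c0] : [/\ 0 <= Num.sqrt u, 0 <= Num.sqrt v & 0 <= Num.sqrt w].
  by rewrite !sqrtr_ge0.
have := sqr_sqrtr (ltW w0); have := sqr_sqrtr (ltW v0); have := sqr_sqrtr (ltW u0).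
move: (Num.sqrt u) (Num.sqrt v) (Num.sqrt w) a0 b0 c0.
move=> a b c a0 b0 c0 aE bE cE; rewrite aE bE cE => ud wd dE.
set S := Num.sqrt (d ^+ 2 - u); set T := Num.sqrt (d ^+ 2 - w).
have SS : S ^+ 2 = d ^+ 2 - u by rewrite sqr_sqrtr // subr_ge0.
have TT : T ^+ 2 = d ^+ 2 - w by rewrite sqr_sqrtr // subr_ge0.
have ST : S * T = b * d + a * c.
  apply/eqP; rewrite -(@eqrXn2 _ 2) ?mulr_ge0 ?addr_ge0 ?sqrtr_ge0 ?mulr_ge0 ?(ltW d0) //.
  rewrite exprMn SS TT; apply/eqP.
  transitivity (d * d ^+ 3 - (u + w) * d ^+ 2 + u * w); first by ring.
  by rewrite dE -aE -bE -cE; ring.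
have dn0 : d != 0 by rewrite gt_eqF.
(* In the right triangle with legs [a], [S] the altitude is [a * S / d], with foot at distance
   [u / d] from the left end; similarly for [c], [T] from the right. The closing side is the
   diameter. *)
pose V : seq (R * R) := [:: (- (d / 2), 0); (u / d - d / 2, a / d * S);
  (d / 2 - w / d, c / d * T); (d / 2, 0)].
pose q (k : 'I_4) := nth 0 V k.
have dvd0 : 0 < d / 2 by rewrite divr_gt0.
exists q, ord_max; split.
  exists 0, (d / 2); split; last first.
    by rewrite /q /=; apply/eqP; rewrite xpair_eqE /=; apply/andP; split;
      apply/eqP; rewrite /=; ring.
  split=> // k; apply/eqP; rewrite -(@eqrXn2 _ 2) ?sqrtr_ge0 ?(ltW dvd0) //; apply/eqP.
  rewrite dist_sqr /q; case: k => [[|[|[|[|k]]]]] //= _.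
  - by ring.
  - transitivity ((u / d - d / 2) ^+ 2 + a ^+ 2 * S ^+ 2 / d ^+ 2); first by field.
    by rewrite aE SS; field.
  - transitivity ((d / 2 - w / d) ^+ 2 + c ^+ 2 * T ^+ 2 / d ^+ 2); first by field.
    by rewrite cE TT; field.
  by ring.
move=> k; rewrite /area_point liftK /side_length dist_sqr /q.
case: k => [[|[|[|k]]]] //= _.
- transitivity ((u / d) ^+ 2 + a ^+ 2 * S ^+ 2 / d ^+ 2); first by field.
  by rewrite aE SS; field.
- transitivity (((d ^+ 2 - u - w) ^+ 2 + a ^+ 2 * S ^+ 2 + c ^+ 2 * T ^+ 2
    - 2 * a * c * (S * T)) / d ^+ 2); first by field.
  rewrite ST SS TT.
  transitivity ((d * d ^+ 3 - d ^+ 2 * (2 * u + 2 * w - a ^+ 2 - c ^+ 2) + (u + w) ^+ 2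
    - a ^+ 2 * u - c ^+ 2 * w - 2 * a * b * c * d
    - 2 * a ^+ 2 * c ^+ 2) / d ^+ 2); first by field.
  by rewrite dE aE cE; field.
transitivity ((w / d) ^+ 2 + c ^+ 2 * T ^+ 2 / d ^+ 2); first by field.
by rewrite cE TT; field.
Qed.

(** * Nonvanishing at points with prescribed residues *)

Lemma poly_neq0_eval (S : idomainType) (p : {poly S}) (e : nat -> S) :
  injective e -> p != 0 -> exists k, p.[e k] != 0.
Proof.
move=> e_inj p0; have : ~~ all (root p) (mkseq e (size p)).
  apply/negP => all_root; have := max_poly_roots p0 all_root.
  by rewrite size_mkseq ltnn mkseq_uniq // => /(_ isT).
by case/allPn => x /mapP [k _ ->] /=; exists k.
Qed.

(** By induction, the last variables are chosen to keep the leading coefficient in the first one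
    nonzero. The values come from arbitrary injective sequences, so that a congruence can be
    imposed. *)
Lemma mpoly_neq0_eval n (R : comNzRingType) (S : idomainType)
    (f : {rmorphism R -> S}) (e : 'I_n -> nat -> S) (p : {mpoly R[n]}) :
  injective f -> (forall i, injective (e i)) -> p != 0 ->
  exists k : 'I_n -> nat, mmap f (fun i => e i (k i)) p != 0.
Proof.
move=> f_inj; elim: n => [|n IH] in e p *.
  move=> _ p0; exists (fun=> 0%N); apply: contra p0.
  have pE : p = (p@_(0%MM))%:MP.
    apply/mpolyP => m; rewrite mcoeffC (_ : m = 0%MM) ?eqxx ?mulr1 //.
    by apply/mnmP => -[].
  rewrite {1}pE mmapC -(rmorph0 f) => /eqP /f_inj p0.
  by rewrite pE p0 mpolyC0.
move=> e_inj p0.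
have lp0 : lead_coef (msplit p) != 0.
  rewrite lead_coef_eq0; apply: contra p0 => /eqP sp0; apply/eqP/msplit_inj.
  by rewrite sp0; apply/esym/(rmorph0 msplit).
have [k hk] := IH (fun i => e (lift ord0 i)) _ (fun i => @e_inj _) lp0.
pose g := mmap f (fun i => e (lift ord0 i) (k i)).
have q0 : map_poly g (msplit p) != 0.
  apply: contra hk => /eqP /(congr1 (fun q : {poly S} => q`_(size (msplit p)).-1)).
  by rewrite coef_map coef0 -lead_coefE /= => ->.
have [k0 hk0] := poly_neq0_eval _ _ _ (@e_inj ord0) q0.
exists (fun i => if unlift ord0 i is Some j then k j else k0).
rewrite mmap_msplit unlift_none; apply: contra hk0.
congr (_.[_] == 0); apply: eq_map_poly => r; rewrite /g /mmap.
apply: eq_bigr => m _; congr (_ * _); apply: mmap1_eq => j /=.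
by rewrite liftK.
Qed.

Lemma rmorph_mmap n (A B C : comNzRingType) (g : {rmorphism B -> C})
    (f : {rmorphism A -> B}) (f' : {rmorphism A -> C}) h h' (p : {mpoly A[n]}) :
  (forall a, g (f a) = f' a) -> (forall i, g (h i) = h' i) ->
  g (mmap f h p) = mmap f' h' p.
Proof.
move=> ff hh; rewrite /mmap rmorph_sum; apply: eq_bigr => m _ /=.
rewrite rmorphM ff /mmap1 rmorph_prod; congr (_ * _).
by apply: eq_bigr => i _ /=; rewrite rmorphXn hh.
Qed.

(* At a positive integer point congruent to (1, 2, 3) modulo 5, the polynomial T
   has degree at most 2 and shares a real root with an irreducible rational
   cubic. *)
Lemma small_vanishing_eq0 (R : realType) (T : {poly {mpoly int[3]}}) :
  (size T < 4)%N ->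
  (forall (q : 'I_4 -> R * R) i, semicyclic_at q i ->
    (map_poly (mmap intr (area_point q i \o lift ord0)) T).[area_point q i ord0] = 0) ->
  T = 0.
Proof.
move=> szT vT; apply/eqP; apply: contraT => T0.
pose e (i : 'I_3) (k : nat) : rat := (i.+1 + 5 * k)%:R.
have e_inj i : injective (e i).
  by move=> k l /eqP; rewrite /e eqr_nat eqn_add2l eqn_mul2l => /eqP.
have lT : lead_coef T != 0 by rewrite lead_coef_eq0.
(* Keeping the leading coefficient of [T] nonzero ensures that its specialization [t] is nonzero. *)
have [k hk] := @mpoly_neq0_eval _ _ rat intr e _ intr_inj e_inj lT.
pose h i := e i (k i); rewrite -/h in hk.
have h_gt0 i : 0 < h i by rewrite ltr0n.
set H := heron_poly (mesym 3 int 1) (mesym 3 int 2) (mesym 3 int 3).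
pose n i : int := (i.+1 + 5 * k (inord i))%N.
have hE i : (i < 3)%N -> h (inord i) = (n i)%:~R by move=> i3; rewrite /h /e inordK.
have nF i : (n i)%:~R = i.+1%:R :> 'F_5.
  rewrite /n -pmulrn natrD natrM.
  by rewrite (_ : 5 = 0 :> 'F_5) ?mul0r ?addr0 //; apply/val_inj.
have szH : size (map_poly (mmap intr h) H) = 4%N.
  by rewrite map_heron_poly size_heron_poly.
have irr_H : irreducible_poly (map_poly (mmap intr h) H).
  apply: cubic_irreducible => [|x].
    by rewrite szH.
  rewrite map_heron_poly /=; have [-> -> ->] := mmap_mesym3 intr h.
  rewrite !hE // /root -!(intrM, intrD).
  by apply: heron_no_rat_root; rewrite !(intrM, intrD) !nF; apply/val_inj.
have [q [i [sc side]]] := semicyclic_quad_exists R (ratr (h (inord 0)))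
  (ratr (h (inord 1))) (ratr (h (inord 2))) ltac:(by rewrite ltr0q)
  ltac:(by rewrite ltr0q) ltac:(by rewrite ltr0q).
have ratr_map (p : {poly {mpoly int[3]}}) :
    map_poly ratr (map_poly (mmap intr h) p) =
    map_poly (mmap intr (area_point q i \o lift ord0)) p :> {poly R}.
  rewrite -map_poly_comp; apply: eq_map_poly => r /=.
  apply: (@rmorph_mmap _ int rat R ratr intr intr) => [a|j]; first exact: ratr_int.
  rewrite /= side; case: j => [[|[|[|j]]]] //= j3; congr (ratr (h _));
    by apply: val_inj; rewrite /= inordK.
pose t := map_poly (mmap intr h) T.
have t0 : t != 0.
  apply: contra hk => /eqP /(congr1 (fun q : {poly rat} => q`_(size T).-1)).
  by rewrite coef_map coef0 -lead_coefE /= => ->.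
(* An irreducible cubic is coprime to a nonzero polynomial of smaller degree, and stays so over the
   reals, where [16 K^2] would be a common root. *)
have : coprimep (map_poly (mmap intr h) H) t.
  rewrite irreducible_poly_coprime //; apply/negP => /(dvdp_leq t0).
  by rewrite szH leqNgt (leq_ltn_trans (size_poly _ _)).
rewrite -(coprimep_map (ratr : {rmorphism rat -> R})) !ratr_map.
move=> /coprimep_root co.
have /co : root (map_poly (mmap intr (area_point q i \o lift ord0)) H)
    (area_point q i ord0).
  have := @heron_vanishes R q i sc; rewrite mmap_msplit msplit_heron => /eqP //.
by rewrite vT // eqxx.
Qed.

(** * Divisibility and the characterization *)

Lemma heron_dvd_vanishing (R : realType) (P : {mpoly int[4]}) :
  vanishes_on_semicyclic R P -> exists S, P = S * heron_mpoly.
Proof.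
move=> vP; pose H := heron_poly (mesym 3 int 1) (mesym 3 int 2) (mesym 3 int 3).
have mon_H : H \is monic by exact: monic_heron_poly.
have PE := Pdiv.RingMonic.rdivp_eq mon_H (msplit P).
exists (munsplit (Pdiv.Ring.rdivp (msplit P) H)).
rewrite -[LHS]msplitK -munsplitM {1}PE.
rewrite (@small_vanishing_eq0 R (Pdiv.Ring.rmodp (msplit P) H)) ?addr0 //.
  have := Pdiv.Ring.ltn_rmodpN0 (msplit P) (monic_neq0 mon_H).
  by rewrite size_heron_poly.
move=> q i sc; have := vP q i sc; rewrite mmap_msplit {1}PE.
have := @heron_vanishes R q i sc; rewrite mmap_msplit msplit_heron -/H.
move: (Pdiv.Ring.rmodp _ _) (Pdiv.Ring.rdivp _ _) => T S H0.
have mapD (f : {rmorphism {mpoly int[3]} -> R}) x : (map_poly f (S * H + T)).[x] =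
    (map_poly f S).[x] * (map_poly f H).[x] + (map_poly f T).[x].
  by rewrite rmorphD rmorphM hornerD hornerM.
by rewrite mapD H0 mulr0 add0r.
Qed.

(** Since [c != 0], the supports agree; if the two leading exponents differed, each would be smaller
    than the other. *)
Lemma monic_scale_eq n (P Q : {mpoly int[n.+1]}) (c : int) : c != 0 ->
  monic_in_first P -> monic_in_first Q -> P = c *: Q -> P = Q.
Proof.
move=> c0 [d [Pd Pm]] [d' [Qd Qm]] PE.
have [e|ne] := eqVneq (U_(ord0) *+ d : 'X_{1..n.+1})%MM (U_(ord0) *+ d')%MM.
  by move: Pd; rewrite PE mcoeffZ e Qd mulr1 => ->; rewrite scale1r.
have mE k : (U_(ord0) *+ k : 'X_{1..n.+1})%MM ord0 = k.
  by rewrite mulmnE mnm1E eqxx mul1n.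
have := Pm (U_(ord0) *+ d')%MM; rewrite mcoeff_msupp PE mcoeffZ Qd mulr1 mE.
rewrite eq_sym in ne; move=> /(_ c0 ne) d'd.
have := Qm (U_(ord0) *+ d)%MM; rewrite mE => dd'.
have : (d < d')%N; last by rewrite ltnNge ltnW.
apply: dd'; last by rewrite eq_sym.
rewrite mcoeff_msupp; apply: contraTneq (oner_neq0 int) => Q0.
by rewrite -Pd PE mcoeffZ Q0 mulr0 eqxx.
Qed.

Lemma is_alpha'_heron (R : realType) (P : {mpoly int[4]}) :
  is_alpha' R 3 P <-> P = heron_mpoly.
Proof.
split=> [[[_ _ irrP] monP _ /heron_dvd_vanishing [S PE]] | ->]; last first.
  by split; [exact: heron_irreducible | exact: heron_monic | exact: heron_homog
    | exact: heron_vanishes].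
(* The cofactor [S] must be a unit, hence a constant, and monicity then makes the two polynomials
   equal. *)
have [|hu] := irrP _ _ PE; last by case: heron_irreducible => _ /negP[].
case/andP => /eqP SE Sunit; apply: (@monic_scale_eq _ _ _ S@_0%MM) => //.
- by apply: contraTneq Sunit => ->; rewrite unitr0.
- exact: heron_monic.
by rewrite PE {1}SE mul_mpolyC.
Qed.

Theorem mainTheorem6 (R : realType) (P : {mpoly int[4]}) :
  is_alpha' R 3 P <->
  (let u2 : {mpoly int[4]} := 'X_ord0 in
   in_u2 P = 16 * discr ('X^3 + sigma 1 *: 'X^2 + (sigma 2 + u2) *: 'X
                         + (sigma 3)%:P)).
Proof.
rewrite is_alpha'_heron /= -in_u2_heron; split=> [-> //|]; exact: in_u2_inj.
Qed.
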